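(* Let $A\in\mathbb R^{n\times n}$, $B\in\mathbb R^{n\times m}$, $C\in\mathbb R^{p\times n}$, $G=BB^{T}$, $Q=C^{T}C$, and let $X,Y\in\mathbb R^{n\times n}$ be symmetric positive semi-definite solutions of $$A^{T}X+XA+Q-XGX=0\qquad\text{and}\qquad AY+YA^{T}-YQY+G=0,$$ respectively. Put $R=A-GX$, $S=A^{T}-QY$, and let $\alpha>0$ be such that $A-\alpha I$, $R-\alpha I$ and $S-\alpha I$ are nonsingular. Let $\{\widehat A_k\},\{X_k\},\{Y_k\}$, $k=0,1,2,\dots$, be the sequences generated by the ADDA iteration with parameter $\alpha$ (defined in the context), and let $\mathscr C(R;\alpha)$, $\mathscr C(S;\alpha)$ be the Cayley transforms defined in the context. Then, for every $k$: (a) $\widehat A_k=(I_n+Y_kX)[\mathscr C(R;\alpha)]^{2^k}$; (b) $0\le X_k\le X_{k+1}\le X$ and $$0\le X-X_k=(I_n+X_kY)[\mathscr C(S;\alpha)]^{2^k}X[\mathscr C(R;\alpha)]^{2^k}\le (I_n+XY)[\mathscr C(S;\alpha)]^{2^k}X[\mathscr C(R;\alpha)]^{2^k};$$ (c) $0\le Y_k\le Y_{k+1}\le Y$ and $$0\le Y-Y_k=(I_n+Y_kX)[\mathscr C(R;\alpha)]^{2^k}Y[\mathscr C(S;\alpha)]^{2^k}\le (I_n+YX)[\mathscr C(R;\alpha)]^{2^k}Y[\mathscr C(S;\alpha)]^{2^k}.$$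
   Context: Order: for symmetric real matrices, $U\le V$ means that $V-U$ is symmetric positive semi-definite (Loewner order). Cayley transform: for a square matrix $T$ with $T-\alpha I$ nonsingular, $\mathscr C(T;\alpha)=(T+\alpha I)(T-\alpha I)^{-1}=(T-\alpha I)^{-1}(T+\alpha I)$. ADDA (alternating direction doubling algorithm) iteration with parameter $\alpha$: set $$A_\alpha=A-\alpha I,\qquad U_\alpha=A_\alpha^{T}+QA_\alpha^{-1}G,\qquad V_\alpha=A_\alpha+GA_\alpha^{-T}Q$$ (where $A_\alpha^{-T}=(A_\alpha^{-1})^{T}$). The initial matrices are $$\widehat A_0=I+2\alpha V_\alpha^{-1},\qquad X_0=2\alpha U_\alpha^{-1}QA_\alpha^{-1},\qquad Y_0=2\alpha A_\alpha^{-1}GU_\alpha^{-1},$$ and for $k=0,1,2,\dots$ $$\widehat A_{k+1}=\widehat A_k(I_n+Y_kX_k)^{-1}\widehat A_k,$$ $$X_{k+1}=X_k+\widehat A_k^{T}(I_n+X_kY_k)^{-1}X_k\widehat A_k,$$ $$Y_{k+1}=Y_k+\widehat A_kY_k(I_n+X_kY_k)^{-1}\widehat A_k^{T}.$$ *)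

(* Defs.v *)
From HB Require Import structures.
From mathcomp Require Import all_boot all_order all_algebra.
From mathcomp Require Import reals.

Set Implicit Arguments.
Unset Strict Implicit.
Unset Printing Implicit Defensive.

Import Order.TTheory GRing.Theory Num.Theory.
Local Open Scope ring_scope.

Definition psdmx (R : realType) (n : nat) (S : 'M[R]_n) : Prop :=
  S^T = S /\ forall v : 'cV[R]_n, 0 <= (v^T *m S *m v) 0 0.

(* Loewner order.  [U] and [V] are not themselves required to be symmetric:
   symmetry of [V - U] is part of the assertion. *)
Definition loewner_le (R : realType) (n : nat) (U V : 'M[R]_n) : Prop :=
  psdmx (V - U).

(* Meaningful when [T - a%:M] is nonsingular, as [invmx] is the identity on
   singular matrices. *)
Definition cayley (R : realType) (n : nat) (T : 'M[R]_n) (a : R) : 'M[R]_n :=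
  (T + a%:M) *m invmx (T - a%:M).

Lemma cayley_comm (R : realType) (n : nat) (T : 'M[R]_n) (a : R) :
  T - a%:M \in unitmx -> cayley T a = invmx (T - a%:M) *m (T + a%:M).
Proof.
move=> uT; rewrite /cayley -[LHS](mulKmx uT); congr (_ *m _).
have cm : comm_mx (T - a%:M) (T + a%:M).
  apply: comm_mxD; last exact: comm_mx_scalar.
  apply: comm_mx_sym; apply: comm_mxB; first exact: comm_mx_refl.
  exact: comm_mx_scalar.
by rewrite mulmxA cm mulmxK.
Qed.

Record adda_state (R : realType) (n : nat) : Type := AddaState {
  addaA : 'M[R]_n;
  addaX : 'M[R]_n;
  addaY : 'M[R]_n
}.

Definition adda_init (R : realType) (n : nat) (A G Q : 'M[R]_n) (alpha : R) :
    adda_state R n :=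
  let Aa := A - alpha%:M in
  let Ua := Aa^T + Q *m invmx Aa *m G in
  let Va := Aa + G *m (invmx Aa)^T *m Q in
  AddaState
    (1%:M + (2 * alpha) *: invmx Va)
    ((2 * alpha) *: (invmx Ua *m Q *m invmx Aa))
    ((2 * alpha) *: (invmx Aa *m G *m invmx Ua)).

Definition adda_step (R : realType) (n : nat) (s : adda_state R n) :
    adda_state R n :=
  let: AddaState Ak Xk Yk := s in
  AddaState
    (Ak *m invmx (1%:M + Yk *m Xk) *m Ak)
    (Xk + Ak^T *m invmx (1%:M + Xk *m Yk) *m Xk *m Ak)
    (Yk + Ak *m Yk *m invmx (1%:M + Xk *m Yk) *m Ak^T).

Definition adda (R : realType) (n : nat) (A G Q : 'M[R]_n) (alpha : R)
    (k : nat) : adda_state R n :=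
  iter k (@adda_step R n) (adda_init A G Q alpha).

(* Main.v *)
(** The columns of [col_mx 1 X] and [col_mx (- Y) 1] span invariant subspaces of
    the Hamiltonian matrix [[A, -G; -Q, -A^T]], on which it acts as [R], [- S].
    One step of the doubling iteration squares the associated matrix pencil
    [[Ak, 0; - Xk, 1] - lambda [1, Yk; 0, Ak^T]], so that
      [Ak = (1 + Yk X) C(R)^N] and [X - Xk = Ak^T X C(R)^N] with [N = 2 ^ k],
    and the same holds after the exchange [Ak, X, Y, R <-> Ak^T, Y, X, S].  All
    the order relations follow by writing the differences as congruences of
    positive semi-definite matrices; e.g. by the two identities above
    [X - Xk = (C(R)^N)^T (X + X Yk X) C(R)^N]. *)
Require Import Defs.
From HB Require Import structures.
From mathcomp Require Import all_boot all_order all_algebra.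
From mathcomp Require Import reals ring lra.
Set Implicit Arguments.
Unset Strict Implicit.
Unset Printing Implicit Defensive.
Import Order.TTheory GRing.Theory Num.Theory.
Local Open Scope ring_scope.

(** * Positive semi-definite matrices, their congruences and resolvents *)

Lemma psdmxD (K : realType) (n : nat) (M N : 'M[K]_n) :
  psdmx M -> psdmx N -> psdmx (M + N).
Proof.
move=> [sM pM] [sN pN]; split=> [|v]; first by rewrite linearD /= sM sN.
by rewrite mulmxDr mulmxDl mxE addr_ge0.
Qed.

Lemma psdmxZ (K : realType) (n : nat) (a : K) (M : 'M[K]_n) :
  0 <= a -> psdmx M -> psdmx (a *: M).
Proof.
move=> a0 [sM pM]; split=> [|v]; first by rewrite linearZ /= sM.
by rewrite -scalemxAr -scalemxAl mxE mulr_ge0.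
Qed.

Lemma psdmx_congr (K : realType) (n m : nat) (M : 'M[K]_n) (N : 'M[K]_(n, m)) :
  psdmx M -> psdmx (N^T *m M *m N).
Proof.
move=> [sM pM]; split=> [|v]; first by rewrite !trmx_mul trmxK sM mulmxA.
by have := pM (N *m v); rewrite trmx_mul !mulmxA.
Qed.

Lemma psdmx1 (K : realType) (n : nat) : psdmx (1%:M : 'M[K]_n).
Proof.
split=> [|v]; first exact: trmx1.
by rewrite mulmx1 mxE sumr_ge0 // => i _; rewrite mxE -expr2 sqr_ge0.
Qed.

Lemma psdmx_gram (K : realType) (n m : nat) (N : 'M[K]_(n, m)) :
  psdmx (N^T *m N).
Proof. by rewrite -[N^T]mulmx1; apply/psdmx_congr/psdmx1. Qed.

Lemma sqnorm_eq0 (K : realType) (n : nat) (v : 'cV[K]_n) :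
  (v^T *m v) 0 0 = 0 -> v = 0.
Proof.
rewrite mxE => /eqP; rewrite psumr_eq0 => [/allP h|i _]; last first.
  by rewrite mxE -expr2 sqr_ge0.
apply/colP => i; have := h i (mem_index_enum _).
by rewrite /= mxE mulf_eq0 orbb !mxE => /eqP.
Qed.

Lemma psdmx_ker (K : realType) (n : nat) (M : 'M[K]_n) (v : 'cV[K]_n) :
  psdmx M -> (v^T *m M *m v) 0 0 = 0 -> M *m v = 0.
Proof.
move=> [sM pM] vMv; apply: sqnorm_eq0.
set u := M *m v; set a := (u^T *m u) 0 0; set c := (u^T *m M *m u) 0 0.
have a0 : 0 <= a by have [_ /(_ u)] := psdmx1 K n; rewrite mulmx1.
(* The quadratic form is affine along the line [u + t v], hence constant. *)
have affine t : 0 <= 2 * t * a + c.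
  have vMT : v^T *m M = u^T by rewrite trmx_mul sM.
  have vu : (v^T *m M *m u) 0 0 = a by rewrite vMT.
  have uv : (u^T *m M *m v) 0 0 = a by rewrite -mulmxA.
  have := pM (u + t *: v).
  have -> : (u + t *: v)^T = u^T + t *: v^T by rewrite linearD linearZ.
  have -> : (u^T + t *: v^T) *m M *m (u + t *: v)
      = u^T *m M *m u + t *: (u^T *m M *m v)
        + (t *: (v^T *m M *m u) + t *: (t *: (v^T *m M *m v))).
    by rewrite !(mulmxDl, mulmxDr, =^~ scalemxAl, =^~ scalemxAr) addrACA.
  rewrite ![fun_of_matrix (_ + _) _ _]mxE ![fun_of_matrix (_ *: _) _ _]mxE.
  by rewrite uv vu vMv -/c => h; lra.
apply/eqP; rewrite eq_le a0 andbT leNgt; apply/negP => agt0.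
(* At this [t] the affine function takes the value [-1], which contradicts its nonnegativity. *)
have := affine (- (c + 1) / (2 * a)).
have -> : 2 * (- (c + 1) / (2 * a)) * a = - (c + 1) by field; rewrite gt_eqF.
lra.
Qed.

(** A row [w] killed by [1 + M N] satisfies [w = - w M N], so [w M w^T = - (w M) N (w M)^T] is both
    nonnegative and nonpositive. Hence [w M = 0], and then [w = 0]. *)
Lemma unitmx_1Dpsd (K : realType) (n : nat) (M N : 'M[K]_n) :
  psdmx M -> psdmx N -> 1%:M + M *m N \in unitmx.
Proof.
move=> pM [sN pN]; rewrite -row_free_unit; apply: inj_row_free => w.
rewrite mulmxDr mulmx1 mulmxA => /eqP; rewrite addr_eq0 => /eqP wE.
have wMw : (w *m M *m w^T) 0 0 = 0.
  have [sM pM'] := pM; apply/eqP; rewrite eq_le.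
  have := pM' w^T; rewrite trmxK => ->; rewrite andbT.
  have := pN (w *m M)^T; rewrite trmxK.
  rewrite [in X in X -> _]trmx_mul sM -[_ *m _ *m (M *m _)]mulmxA.
  move=> h; rewrite {2}wE linearN /= !trmx_mul sM sN mulmxN mxE oppr_le0.
  by rewrite !mulmxA in h *.
have Mw0 : M *m w^T = 0 by apply: psdmx_ker pM _; rewrite trmxK.
have : w *m M = 0 by rewrite -[w]trmxK -[M](proj1 pM) -trmx_mul Mw0 trmx0.
by move=> wM0; rewrite wE wM0 mul0mx oppr0.
Qed.

Lemma invmx_mul (K : realType) (n : nat) (M N : 'M[K]_n) :
  M \in unitmx -> N \in unitmx -> invmx (M *m N) = invmx N *m invmx M.
Proof.
move=> uM uN; have uMN : M *m N \in unitmx by rewrite unitmx_mul uM.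
by apply: (can_inj (mulKmx uMN)); rewrite mulmxV // mulmxA mulmxK // mulmxV.
Qed.

Lemma push_through (K : realType) (n : nat) (M N : 'M[K]_n) :
  1%:M + M *m N \in unitmx -> 1%:M + N *m M \in unitmx ->
  invmx (1%:M + M *m N) *m M = M *m invmx (1%:M + N *m M).
Proof.
move=> uMN uNM; rewrite -[LHS](mulmxK uNM) -[invmx _ *m M *m _]mulmxA.
have -> : M *m (1%:M + N *m M) = (1%:M + M *m N) *m M.
  by rewrite mulmxDr mulmxDl mulmx1 mul1mx mulmxA.
by rewrite mulKmx.
Qed.

(** With [W] the inverse of [1 + N M], this matrix is the congruence [W^T (M + M N M) W]. Both the
    initial matrices and the increments of the iteration reduce to this form. *)
Lemma psdmx_resolvent (K : realType) (n : nat) (M N : 'M[K]_n) :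
  psdmx M -> psdmx N -> psdmx (invmx (1%:M + M *m N) *m M).
Proof.
move=> pM pN; have uMN := unitmx_1Dpsd pM pN; have uNM := unitmx_1Dpsd pN pM.
have [sM _] := pM; have [sN _] := pN.
set W := invmx (1%:M + N *m M).
have WT : W^T = invmx (1%:M + M *m N).
  by rewrite trmx_inv linearD /= trmx1 trmx_mul sM sN.
have -> : invmx (1%:M + M *m N) *m M
    = W^T *m (M + M^T *m N *m M) *m W.
  have -> : M + M^T *m N *m M = (1%:M + M *m N) *m M.
    by rewrite sM mulmxDl mul1mx.
  by rewrite WT mulKmx // push_through.
exact/psdmx_congr/psdmxD/psdmx_congr.
Qed.

(** * The doubling step on deflating subspaces *)

(* Block form of [M *m V = L *m V *m C] for [M = [Ak, 0; - Xk, 1]],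
   [L = [1, Yk; 0, Ak^T]] and [V = col_mx 1 X]. *)
Definition deflating (K : realType) (n : nat) (X C Ak Xk Yk : 'M[K]_n) : Prop :=
  Ak = (1%:M + Yk *m X) *m C /\ X - Xk = Ak^T *m X *m C.

Lemma deflating_step (K : realType) (n : nat) (X C Ak Xk Yk : 'M[K]_n) :
  psdmx Xk -> psdmx Yk -> deflating X C Ak Xk Yk ->
  deflating X (C *m C) (Ak *m invmx (1%:M + Yk *m Xk) *m Ak)
    (Xk + Ak^T *m invmx (1%:M + Xk *m Yk) *m Xk *m Ak)
    (Yk + Ak *m Yk *m invmx (1%:M + Xk *m Yk) *m Ak^T).
Proof.
move=> pX pY [eA eX].
have uXY := unitmx_1Dpsd pX pY; have uYX := unitmx_1Dpsd pY pX.
have [sX _] := pX; have [sY _] := pY.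
split.
  have -> : (1%:M + (Yk + Ak *m Yk *m invmx (1%:M + Xk *m Yk) *m Ak^T) *m X)
      *m (C *m C) = (1%:M + Yk *m X) *m C *m C
        + Ak *m (Yk *m invmx (1%:M + Xk *m Yk)) *m (Ak^T *m X *m C) *m C.
    by rewrite !mulmxDl !mulmxA addrA.
  rewrite -eA -eX -push_through // -mulmxDl {2}eA !mulmxA; congr (_ *m C).
  (* With [W] the inverse of [1 + Yk Xk], the summand [Ak] is written as [Ak W (1 + Yk Xk)], so that
     [Ak W] factors out and [1 + Yk Xk + Yk (X - Xk) = 1 + Yk X] remains. *)
  rewrite -{2}(mulmxKV uYX Ak) -!mulmxA -!mulmxDr; congr (_ *m (_ *m _)).
  by rewrite -addrA -mulmxDr [Xk + _]addrC subrK.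
set Z := invmx (1%:M + Xk *m Yk).
have ZT : (invmx (1%:M + Yk *m Xk))^T = Z.
  by rewrite trmx_inv linearD /= trmx1 trmx_mul sX sY.
(* Inserting [Ak = (1 + Yk X) C] turns the new difference into [Ak^T (X - Z Xk (1 + Yk X)) C]. This
   identity brings back [X - Xk], whose known form supplies the second factor [C]. *)
have eZ : X - Z *m Xk *m (1%:M + Yk *m X) = Z *m (X - Xk).
  rewrite -{1}(mulKmx uXY X) -/Z -mulmxA -mulmxBr; congr (_ *m _).
  by rewrite mulmxDl mulmxDr mul1mx mulmx1 mulmxA opprD addrACA subrr addr0.
have -> : (Ak *m invmx (1%:M + Yk *m Xk) *m Ak)^T *m X *m (C *m C)
    = Ak^T *m (Z *m (Ak^T *m X *m C)) *m C.
  by rewrite !trmx_mul ZT !mulmxA.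
rewrite -eX -eZ opprD addrA eX mulmxBr mulmxBl; congr (_ - _).
by rewrite -!mulmxA; do 3!congr (_ *m _).
Qed.

Lemma deflating_loewner (K : realType) (n : nat) (X C Ak Xk Yk : 'M[K]_n) :
  psdmx X -> psdmx Yk -> deflating X C Ak Xk Yk -> psdmx (X - Xk).
Proof.
move=> pX pY [eA ->]; have [sX _] := pX; have [sY _] := pY.
have -> : Ak^T *m X *m C = C^T *m (X + X^T *m Yk *m X) *m C.
  by rewrite eA trmx_mul linearD /= trmx1 trmx_mul sX sY mulmxDr mulmx1
             !mulmxDl mulmxDr mulmxDl !mulmxA.
exact/psdmx_congr/psdmxD/psdmx_congr.
Qed.

(** * The initial matrices of the iteration *)

Section InitialState.

Variables (K : realType) (n : nat) (A G Q : 'M[K]_n) (a : K).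
Hypotheses (pG : psdmx G) (pQ : psdmx Q) (a0 : 0 < a)
  (uA : A - a%:M \in unitmx).

Local Notation Aa := (A - a%:M).
Local Notation P := ((invmx Aa)^T *m Q *m invmx Aa).
Local Notation Ua := (Aa^T + Q *m invmx Aa *m G).
Local Notation Va := (Aa + G *m (invmx Aa)^T *m Q).

Let uAT : Aa^T \in unitmx. Proof. by rewrite unitmx_tr. Qed.
Let pP : psdmx P. Proof. exact: psdmx_congr. Qed.

(** Since [P] is a congruence of [Q], this factorization makes the invertibility of [Ua] a case of
    [unitmx_1Dpsd]. *)
Let UaE : Ua = Aa^T *m (1%:M + P *m G).
Proof. by rewrite mulmxDr mulmx1 -!mulmxA trmx_inv mulKVmx. Qed.

Let uU : Ua \in unitmx.
Proof. by rewrite UaE unitmx_mul uAT unitmx_1Dpsd. Qed.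

Let UaT : Ua^T = Va.
Proof.
have [sG _] := pG; have [sQ _] := pQ.
by rewrite linearD /= trmxK !trmx_mul sG sQ mulmxA.
Qed.

Let uV : Va \in unitmx. Proof. by rewrite -UaT unitmx_tr. Qed.

(** Rewrites the initial [Y] with the inverse of [Va], the one that also occurs in the initial
    [A]. *)
Let invU_invV : invmx Aa *m G *m invmx Ua = invmx Va *m G *m (invmx Aa)^T.
Proof.
have key : Va *m (invmx Aa *m G) = G *m (invmx Aa)^T *m Ua.
  rewrite mulmxDl mulKVmx // mulmxDr trmx_inv mulmxKV //.
  by rewrite !mulmxA.
by rewrite -(mulKmx uV (invmx Aa *m G)) key -[LHS]mulmxA mulmxK // !mulmxA.
Qed.

Lemma adda_init_psd :
  psdmx (addaX (adda_init A G Q a)) /\ psdmx (addaY (adda_init A G Q a)).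
Proof.
have aa0 : 0 <= 2 * a by rewrite mulr_ge0 // ltW.
split; apply: psdmxZ => //=.
  rewrite UaE.
  have -> : invmx (Aa^T *m (1%:M + P *m G)) *m Q *m invmx Aa
    = invmx (1%:M + P *m G) *m P.
    by rewrite invmx_mul ?unitmx_1Dpsd // trmx_inv !mulmxA.
  exact: psdmx_resolvent.
rewrite UaE invmx_mul ?unitmx_1Dpsd //.
have -> : invmx Aa *m G *m (invmx (1%:M + P *m G) *m invmx Aa^T)
   = (invmx Aa)^T^T *m (invmx (1%:M + G *m P) *m G) *m (invmx Aa)^T.
  by rewrite trmxK push_through ?unitmx_1Dpsd // trmx_inv !mulmxA.
exact/psdmx_congr/psdmx_resolvent.
Qed.

(** Base case of the symmetry by which every statement about [Y] follows from the one about [X]. *)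
Lemma adda_init_dual :
  adda_init A^T Q G a
    = let: AddaState A' X' Y' := adda_init A G Q a in AddaState A'^T Y' X'.
Proof.
have [sQ _] := pQ.
have AaT : A^T - a%:M = Aa^T by rewrite linearB /= tr_scalar_mx.
rewrite /adda_init AaT trmxK -trmx_inv trmxK -invU_invV.
have VaT : Va^T = Ua by rewrite -UaT trmxK.
congr AddaState.
  by rewrite [RHS]linearD /= [(_ *: _)^T in RHS]linearZ /= trmx1 trmx_inv VaT.
(* The third component comes out as the transpose of the initial [X], which is symmetric. *)
have [[/= <- _] _] := adda_init_psd.
by rewrite [RHS]linearZ /= !trmx_mul sQ [(invmx Ua)^T]trmx_inv UaT !mulmxA.
Qed.

(* Since [X] solves the Riccati equation,
   [X (R + a) = - (A - a)^T X - Q] with [R = A - G X]. *)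
Lemma deflating_init (X : 'M[K]_n) :
  A^T *m X + X *m A + Q - X *m G *m X = 0 ->
  A - G *m X - a%:M \in unitmx ->
  let s := adda_init A G Q a in
  deflating X (cayley (A - G *m X) a) (addaA s) (addaX s) (addaY s).
Proof.
move=> hX uR /=; rewrite /cayley invU_invV.
set R := A - G *m X in uR *.
have XR : X *m (R + a%:M) = - (Aa^T *m X) - Q.
  apply/eqP; rewrite -subr_eq0 -hX; apply/eqP.
  have -> : Aa^T = A^T - a%:M by rewrite linearB /= tr_scalar_mx.
  rewrite /R !mulmxDr mulmxN mulmxBl mul_mx_scalar mul_scalar_mx !mulmxA.
  move: (X *m A) (X *m G *m X) (a *: X) (A^T *m X) => M1 M2 M3 M4.
  by apply/matrixP => i j; rewrite !mxE; ring.
have RD : R + a%:M = R - a%:M + (2 * a) *: 1%:M.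
  by rewrite scalemx1 mulr_natl mulr2n raddfD /= addrA subrK.
have RA : R - a%:M = Aa - G *m X by rewrite addrAC.
(* Multiplying by [R - a] clears the inverse in the Cayley transform. Writing
   [R + a = (R - a) + 2 a] then leaves only the coefficients of [2 a] to compare. *)
split; rewrite mulmxA; apply: (can_inj (mulmxK uR)); rewrite mulmxKV //.
  have -> : (1%:M + (2 * a) *: (invmx Va *m G *m (invmx Aa)^T) *m X)
        *m (R + a%:M)
      = R - a%:M + (2 * a) *: (1%:M
          + invmx Va *m (G *m ((invmx Aa)^T *m (X *m (R + a%:M))))).
    by rewrite mulmxDl mul1mx {1}RD -!scalemxAl -addrA -scalerDr !mulmxA.
  rewrite mulmxDl mul1mx -scalemxAl; congr (_ + _ *: _).
  have -> : (invmx Aa)^T *m (X *m (R + a%:M)) = - X - (invmx Aa)^T *m Q.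
    by rewrite XR mulmxBr mulmxN trmx_inv mulKmx.
  apply: (can_inj (mulKmx uV)).
  rewrite mulKVmx // [RHS]mulmxDr mulmx1 mulKVmx // mulmxBr mulmxN mulmxA RA.
  by rewrite addrACA subrr addr0.
have -> : (1%:M + (2 * a) *: invmx Va)^T = 1%:M + (2 * a) *: invmx Ua.
  by rewrite [LHS]linearD /= [(_ *: _)^T in LHS]linearZ /= trmx1 trmx_inv
             -UaT trmxK.
have -> : (1%:M + (2 * a) *: invmx Ua) *m X *m (R + a%:M)
    = X *m (R - a%:M) + (2 * a) *: (X + invmx Ua *m (X *m (R + a%:M))).
  rewrite 2!mulmxDl mul1mx {1}RD mulmxDr -scalemxAr mulmx1 -!scalemxAl.
  by rewrite -addrA -scalerDr !mulmxA.
rewrite mulmxBl -!scalemxAl -scalerN; congr (_ + _ *: _).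
apply: (can_inj (mulKmx uU)).
rewrite mulmxN -(mulmxA (_ *m Q)) -(mulmxA (invmx _)) mulKVmx // [RHS]mulmxDr.
rewrite mulKVmx // XR RA mulmxBr mulVmx // mulmxBr mulmx1 mulmxDl !mulmxA.
by rewrite opprB [RHS]addrACA subrr add0r.
Qed.

End InitialState.

(** * Invariants along the iteration *)

Lemma adda_step_dual (K : realType) (n : nat) (Ak Xk Yk : 'M[K]_n) :
  psdmx Xk -> psdmx Yk ->
  adda_step (AddaState Ak^T Yk Xk)
    = let: AddaState A' X' Y' := adda_step (AddaState Ak Xk Yk) in
      AddaState A'^T Y' X'.
Proof.
move=> pX pY; have [sX _] := pX; have [sY _] := pY.
have uXY := unitmx_1Dpsd pX pY; have uYX := unitmx_1Dpsd pY pX.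
rewrite /= trmxK !trmx_mul trmx_inv linearD /= trmx1 trmx_mul sX sY.
rewrite -[Ak *m _ *m Yk]mulmxA push_through // !mulmxA.
by rewrite -[_ *m invmx _ *m Xk]mulmxA push_through // !mulmxA.
Qed.

Lemma adda_step_psd (K : realType) (n : nat) (Ak Xk Yk : 'M[K]_n) :
  psdmx Xk -> psdmx Yk ->
  psdmx (addaX (adda_step (AddaState Ak Xk Yk)) - Xk) /\
  psdmx (addaY (adda_step (AddaState Ak Xk Yk)) - Yk).
Proof.
move=> pX pY; rewrite /= ![_ + _ - _]addrAC !subrr !add0r; split.
  rewrite -[Ak^T *m _ *m Xk]mulmxA.
  exact/psdmx_congr/psdmx_resolvent.
rewrite -[Ak *m Yk *m _]mulmxA -push_through ?unitmx_1Dpsd //.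
rewrite -{1}[Ak]trmxK; exact/psdmx_congr/psdmx_resolvent.
Qed.

Lemma expmx_double (K : realType) (n : nat) (M : 'M[K]_n) (k : nat) :
  M ^+ (2 ^ k.+1) = M ^+ (2 ^ k) *m M ^+ (2 ^ k).
Proof. by rewrite expnS mul2n -addnn exprD. Qed.

(** Semi-definiteness of [Xk] and [Yk] is carried through the induction because it makes [1 + Xk Yk]
    invertible in [deflating_step]. *)
Lemma adda_deflating (K : realType) (n : nat) (A G Q X Y : 'M[K]_n) (a : K) :
  psdmx G -> psdmx Q -> 0 < a -> A - a%:M \in unitmx ->
  A^T *m X + X *m A + Q - X *m G *m X = 0 ->
  A *m Y + Y *m A^T - Y *m Q *m Y + G = 0 ->
  A - G *m X - a%:M \in unitmx -> A^T - Q *m Y - a%:M \in unitmx ->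
  forall k, let: AddaState Ak Xk Yk := adda A G Q a k in
  [/\ psdmx Xk, psdmx Yk,
      deflating X (cayley (A - G *m X) a ^+ (2 ^ k)) Ak Xk Yk
    & deflating Y (cayley (A^T - Q *m Y) a ^+ (2 ^ k)) Ak^T Yk Xk].
Proof.
move=> pG pQ a0 uA hX hY uR uS; elim=> [|k].
  have [pX pY] := adda_init_psd pG pQ a0 uA.
  rewrite expn0 !expr1; split=> //; first exact: deflating_init.
  have uAT : A^T - a%:M \in unitmx.
    by rewrite -unitmx_tr linearB /= trmxK tr_scalar_mx.
  have hY' : A^T^T *m Y + Y *m A^T + G - Y *m Q *m Y = 0.
    by rewrite trmxK addrAC.
  have := deflating_init pQ pG uAT hY' uS.
  by rewrite (adda_init_dual pG pQ a0 uA).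
rewrite /adda iterS -/(adda A G Q a k).
case: (adda A G Q a k) => Ak Xk Yk [pX pY dX dY].
have [iX iY] := adda_step_psd Ak pX pY.
rewrite !expmx_double; split.
- by rewrite -[_ + _](subrK Xk); apply: psdmxD.
- by rewrite -[_ + _](subrK Yk); apply: psdmxD.
- exact: deflating_step.
(* The step is applied to the exchanged state [(Ak^T, Yk, Xk)] and carried back by duality. *)
have := deflating_step pY pX dY.
have := adda_step_dual Ak pX pY.
by rewrite /= => -[-> -> ->].
Qed.

(** * Upper bounds and conclusion *)

(** Inserting [Ak^T = (1 + Xk Y) CY] into [X - Xk = Ak^T X CX] gives the equality. With
    [M = CY X CX], the two sides of the last bound differ by [(X - Xk) Y M], which is
    [M^T (Y + Y Xk Y) M] because [X - Xk] is symmetric and equals [(1 + Xk Y) M]. *)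
Lemma deflating_upper (K : realType) (n : nat)
    (X Y Xk Yk Ak CX CY : 'M[K]_n) :
  psdmx X -> psdmx Y -> psdmx Xk -> psdmx Yk ->
  deflating X CX Ak Xk Yk -> deflating Y CY Ak^T Yk Xk ->
  [/\ psdmx (X - Xk), X - Xk = (1%:M + Xk *m Y) *m CY *m X *m CX
    & loewner_le ((1%:M + Xk *m Y) *m CY *m X *m CX)
                 ((1%:M + X *m Y) *m CY *m X *m CX)].
Proof.
move=> pX pY pXk pYk dX [eA _].
have pD := deflating_loewner pX pYk dX.
have eD : X - Xk = (1%:M + Xk *m Y) *m CY *m X *m CX.
  by rewrite dX.2 eA.
split=> //; rewrite /loewner_le -!mulmxA -mulmxBl.
have [sY _] := pY; have [sXk _] := pXk.
have eM : X - Xk = (1%:M + Xk *m Y) *m (CY *m (X *m CX)).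
  by rewrite eD !mulmxA.
move: (CY *m (X *m CX)) eM => M eM.
have -> : (1%:M + X *m Y - (1%:M + Xk *m Y)) *m M
    = M^T *m (Y + Y^T *m Xk *m Y) *m M.
  have -> : 1%:M + X *m Y - (1%:M + Xk *m Y) = (X - Xk)^T *m Y.
    by rewrite pD.1 mulmxBl opprD addrACA subrr add0r.
  rewrite eM trmx_mul linearD /= trmx1 trmx_mul sY sXk.
  by rewrite -[M^T *m _ *m Y]mulmxA mulmxDl mul1mx.
exact/psdmx_congr/psdmxD/psdmx_congr.
Qed.

Theorem theorem2 (K : realType) (n m p : nat)
    (A : 'M[K]_n) (B : 'M[K]_(n, m)) (C : 'M[K]_(p, n)) (G Q : 'M[K]_n)
    (hG : G = B *m B^T) (hQ : Q = C^T *m C)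
    (X Y : 'M[K]_n) (hXpsd : psdmx X) (hYpsd : psdmx Y)
    (hX : A^T *m X + X *m A + Q - X *m G *m X = 0)
    (hY : A *m Y + Y *m A^T - Y *m Q *m Y + G = 0)
    (R S : 'M[K]_n) (hR : R = A - G *m X) (hS : S = A^T - Q *m Y)
    (alpha : K) (halpha : 0 < alpha)
    (hAa : A - alpha%:M \in unitmx)
    (hRa : R - alpha%:M \in unitmx)
    (hSa : S - alpha%:M \in unitmx)
    (Ah Xs Ys : nat -> 'M[K]_n)
    (hAh : forall k, Ah k = addaA (adda A G Q alpha k))
    (hXs : forall k, Xs k = addaX (adda A G Q alpha k))
    (hYs : forall k, Ys k = addaY (adda A G Q alpha k))
    (k : nat) :
  [/\ Ah k = (1%:M + Ys k *m X) *m cayley R alpha ^+ (2 ^ k)%N,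
      [/\ loewner_le 0 (Xs k), loewner_le (Xs k) (Xs k.+1)
        & loewner_le (Xs k.+1) X]
      /\
      [/\ loewner_le 0 (X - Xs k),
          X - Xs k = (1%:M + Xs k *m Y) *m cayley S alpha ^+ (2 ^ k)%N
                       *m X *m cayley R alpha ^+ (2 ^ k)%N
        & loewner_le
            ((1%:M + Xs k *m Y) *m cayley S alpha ^+ (2 ^ k)%N
               *m X *m cayley R alpha ^+ (2 ^ k)%N)
            ((1%:M + X *m Y) *m cayley S alpha ^+ (2 ^ k)%N
               *m X *m cayley R alpha ^+ (2 ^ k)%N)]
    & [/\ loewner_le 0 (Ys k), loewner_le (Ys k) (Ys k.+1)
        & loewner_le (Ys k.+1) Y]
      /\
      [/\ loewner_le 0 (Y - Ys k),
          Y - Ys k = (1%:M + Ys k *m X) *m cayley R alpha ^+ (2 ^ k)%N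
                       *m Y *m cayley S alpha ^+ (2 ^ k)%N
        & loewner_le
            ((1%:M + Ys k *m X) *m cayley R alpha ^+ (2 ^ k)%N
               *m Y *m cayley S alpha ^+ (2 ^ k)%N)
            ((1%:M + Y *m X) *m cayley R alpha ^+ (2 ^ k)%N
               *m Y *m cayley S alpha ^+ (2 ^ k)%N)]].
Proof.
have pG : psdmx G by rewrite hG -{1}[B]trmxK; apply: psdmx_gram.
have pQ : psdmx Q by rewrite hQ; apply: psdmx_gram.
rewrite hR in hRa *; rewrite hS in hSa *.
have inv := adda_deflating pG pQ halpha hAa hX hY hRa hSa.
rewrite hAh !hXs !hYs.
have adda_succ : adda A G Q alpha k.+1 = adda_step (adda A G Q alpha k) by [].
(* The invariant at [k.+1] serves only for the bounds of the next iterates by [X] and [Y]. *)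
have := inv k; have := inv k.+1; rewrite adda_succ.
case: (adda A G Q alpha k) => Ak Xk Yk [pX' pY' dX' dY'] [pX pY dX dY].
have [iX iY] := adda_step_psd Ak pX pY.
have [? ? ?] := deflating_upper hXpsd hYpsd pX pY dX dY.
(* In the exchanged use of [deflating_upper] the matrix [Ak^T] plays the part of [Ak], so [Ak] must
   appear as its transpose. *)
have dX2 := dX; rewrite -[Ak]trmxK in dX2.
have [? ? ?] := deflating_upper hYpsd hXpsd pY pX dY dX2.
split; first by case: dX.
- split; last by split; rewrite /loewner_le ?subr0.
  split; rewrite /loewner_le ?subr0 //.
  exact: (deflating_loewner hXpsd pY' dX').
split; last by split; rewrite /loewner_le ?subr0.
split; rewrite /loewner_le ?subr0 //.
exact: (deflating_loewner hYpsd pX' dY').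
Qed.
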